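(* Let $p$ be a prime and let $G$ be a nontrivial finite $p$-group. Then $G$ admits a faithful, self-similar action by automorphisms on the rooted $p$-ary tree such that the stabilizer in $G$ of the first level of the tree is abelian if and only if $G$ is a split extension of an elementary abelian $p$-group by a cyclic group of order $p$.
   Context: Rooted $k$-ary tree: let $X=\{0,\dots,k-1\}$. The rooted $k$-ary tree is the graph with vertex set $X^*$ (finite words over $X$), where the children of a vertex $u$ are the vertices $ux$, $x\in X$; the empty word is the root. The first level is the set of words of length $1$, i.e. $X$. Automorphisms of the tree fix the root. Every automorphism $g$ of the tree $X^*$ decomposes uniquely as $g=\pi_g\,(g|_0,\dots,g|_{k-1})$, where $\pi_g$ is a permutation of $X$ (the root permutation of $g$) and $g|_0,\dots,g|_{k-1}$ are automorphisms of $X^*$ (the sections of $g$), such that $g(xw)=\pi_g(x)\,g|_x(w)$ for every $x\in X$ and $w\in X^*$. A group of automorphisms of $X^*$ is self-similar if all sections of all of its elements again belong to the group. A faithful, self-similar action of a group $G$ on the rooted $k$-ary tree is a faithful action of $G$ by tree automorphisms whose image in the automorphism group of $X^*$ is a self-similar group. The first level stabilizer is the subgroup of all $g\in G$ that fix every vertex of the first level (equivalently, $\pi_g$ is trivial). ''$G$ is a split extension of an elementary abelian $p$-group by a cyclic group of order $p$'' means: $G$ has a normal subgroup $H$ that is an elementary abelian $p$-group (the trivial group is allowed) with $G/H$ cyclic of order $p$, such that the short exact sequence $1\to H\to G\to G/H\to 1$ splits. *)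

(* Defs.v *)
From mathcomp Require Import all_boot all_fingroup all_solvable.
Set Implicit Arguments.
Unset Strict Implicit.
Unset Printing Implicit Defensive.

Import GroupScope.

Section RegularTree.

Variable k : nat.

(* Vertices of the rooted k-ary tree: finite words over X = {0, ..., k - 1}.  *)
Definition word := seq 'I_k.

Definition child (u v : word) : bool := [exists x, v == rcons u x].

Definition tree_adj : rel word := [rel u v | child u v || child v u].

Definition tree_aut (g : word -> word) : Prop :=
  [/\ bijective g, g [::] = [::]
    & forall u v, tree_adj (g u) (g v) = tree_adj u v].

(* The section of g at the letter x; meaningful when g is a tree automorphism *)
(* (see tree_autE and section_aut below).                                     *)
Definition section (g : word -> word) (x : 'I_k) : word -> word :=
  fun w => behead (g (x :: w)).

Lemma child_cons x u v : child (x :: u) (x :: v) = child u v.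
Proof.
by apply: eq_existsb => y; rewrite rcons_cons eqseq_cons eqxx.
Qed.

Lemma tree_adj_cons x u v : tree_adj (x :: u) (x :: v) = tree_adj u v.
Proof. by rewrite /tree_adj /= !child_cons. Qed.

Lemma childP u v : reflect (exists x, v = rcons u x) (child u v).
Proof. exact: 'exists_eqP. Qed.

Lemma tree_adjP u v :
  reflect (child u v \/ child v u) (tree_adj u v).
Proof. exact: orP. Qed.

Lemma tree_aut_child g u x :
  tree_aut g -> exists y, g (rcons u x) = rcons (g u) y.
Proof.
case=> bij_g g0 adj_g; elim/last_ind: u x => [|u y IHu] x.
  have: tree_adj (g [::]) (g [:: x]).
    by rewrite adj_g; apply/tree_adjP; left; apply/childP; exists x.
  by rewrite g0 => /tree_adjP[] /childP[y]; [by exists y | by case: (g _)].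
have: tree_adj (g (rcons u y)) (g (rcons (rcons u y) x)).
  by rewrite adj_g; apply/tree_adjP; left; apply/childP; exists x.
case/tree_adjP=> /childP[z] //; first by exists z.
have [t ->] := IHu y => /rcons_inj[/(bij_inj bij_g) Eu _].
by have := congr1 size Eu; rewrite !size_rcons => /eqP; elim: (size u).
Qed.

(* The decomposition g (x w) = pi_g (x) g|_x (w).                             *)
Lemma tree_autE g : tree_aut g ->
  exists s : {perm 'I_k}, forall x w, g (x :: w) = s x :: section g x w.
Proof.
move=> aut_g; have [bij_g g0 _] := aut_g.
pose f x := head x (g [:: x]).
have fE x : g [:: x] = [:: f x].
  by have [y] := tree_aut_child [::] x aut_g; rewrite /f g0 /= => ->.
have inj_f : injective f.
  by move=> x y Exy; have := fE x; rewrite Exy -fE => /(bij_inj bij_g)[].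
exists (perm inj_f) => x w; rewrite permE /section.
elim/last_ind: w => [|w y IHw]; first by rewrite fE.
have [z] := tree_aut_child (x :: w) y aut_g.
by rewrite rcons_cons => ->; rewrite IHw.
Qed.

Lemma section_aut g x : tree_aut g -> tree_aut (section g x).
Proof.
move=> aut_g; have [[h gK hK] g0 adj_g] := aut_g.
have aut_h : tree_aut h.
  split; [by exists g | by rewrite -g0 gK | by move=> u v; rewrite -adj_g !hK].
have [s gE] := tree_autE aut_g; have [t hE] := tree_autE aut_h.
have st y : t (s y) = y by have := gK [:: y]; rewrite gE hE => -[].
split=> [||u v].
- exists (section h (s x)) => w.
    by have := gK (x :: w); rewrite gE hE => -[].
  by have := hK (s x :: w); rewrite hE st gE => -[].
- have [y] := tree_aut_child [::] x aut_g.
  by rewrite g0 /= gE => -[_ ->].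
by rewrite -(tree_adj_cons (s x)) -!gE adj_g tree_adj_cons.
Qed.

End RegularTree.

Section TreeActions.

Variables (k : nat) (gT : finGroupType) (G : {group gT}).

(* Actions are right actions, as everywhere in the library: [to w g] is the   *)
(* image of the word w under g. Passing from a left action g w to the right   *)
(* action g^-1 w changes neither the group of tree automorphisms induced by G *)
(* nor the stabilisers.                                                       *)
Implicit Type to : action G (word k).

Definition acts_by_tree_aut to : Prop :=
  {in G, forall g, tree_aut (fun w => to w g)}.

Definition faithful_on_tree to : Prop :=
  {in G, forall g, (forall w, to w g = w) -> g = 1}.

Definition self_similar to : Prop :=
  {in G, forall g (x : 'I_k),
    exists2 h, h \in G & section (fun w => to w g) x =1 (fun w => to w h)}.

Definition level1_stab to : {set gT} :=
  [set g in G | [forall x : 'I_k, to [:: x] g == [:: x]]].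

End TreeActions.

Definition split_elementary_abelian_by_Cp (p : nat) (gT : finGroupType)
    (G : {group gT}) : Prop :=
  exists H : {group gT},
    [/\ H <| G, p.-abelem H, cyclic (G / H), #|G / H| = p & [splits G, over H]].

(* Main.v *)
Require Import Defs.
From mathcomp Require Import all_boot all_fingroup all_solvable.
Import GroupScope.

(** The link between the two sides is the notion of a simple virtual
    endomorphism: a homomorphism [phi] from a subgroup [H] of index [p] in [G]
    back to [G] such that no nontrivial normal subgroup of [G] contained in [H]
    is mapped into itself by [phi].

    Given a faithful self-similar action, the root permutations form a nontrivial
    [p]-subgroup of the symmetric group of degree [p], so they have order [p] and
    act transitively. Hence the first level stabilizer [H] has index [p], and
    sending an element of [H] to its section at a fixed letter is a virtual
    endomorphism. Sections at different letters are conjugate, so an invariant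
    normal subgroup would act trivially on the whole tree: the virtual
    endomorphism is simple ([endo_at_simple]). Conversely, translating the cosets
    of [H] and applying [phi] to the resulting cocycle defines a self-similar
    tree action whose first level stabilizer is contained in [H], and simplicity
    of [phi] makes it faithful ([coset_tree_action_faithful]).

    It remains to see which [p]-groups have a simple virtual endomorphism with
    abelian domain [H] of index [p].

    If [phi] is one and [H] is nontrivial, some central [c] of order [p] in [H]
    is mapped outside [H] ([simple_endo_central_escape]); otherwise the central
    elements of [H] of order dividing [p] would form an invariant subgroup. Then
    [phi c] generates a complement of [H]. Multiplying elements of [H] by powers
    of [c] moves their images into [H] without changing their [p]-th powers, so
    the subgroup of [p]-th powers in [H] is invariant, hence trivial, and [H] is
    elementary abelian ([simple_endo_split]).

    If [G] is a split extension of an elementary abelian [H] by a group of order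
    [p] generated by [t], let [phi] shift a basis of [H :&: 'Z(G)] one step
    towards [t] and kill a complement of that group in [H]. Iterating [phi]
    pushes every nontrivial element of [H :&: 'Z(G)] out of [H]
    ([truncated_shift]), and in a [p]-group every nontrivial normal subgroup
    contained in [H] meets [H :&: 'Z(G)], so [phi] is simple
    ([split_simple_endo]). *)

Set Implicit Arguments.
Unset Strict Implicit.
Unset Printing Implicit Defensive.

(** * Simple virtual endomorphisms *)

(** A homomorphism from a subgroup [H] of [G] back to [G] is a virtual
    endomorphism of [G]; it is simple when its core, the largest normal subgroup
    of [G] inside [H] that it maps into itself, is trivial. *)
Definition simple_endo (gT : finGroupType) (G H : {group gT})
    (phi : {morphism H >-> gT}) : Prop :=
  phi @* H \subset G /\
  forall K : {group gT},
    K <| G -> K \subset H -> phi @* K \subset K -> K :=: 1.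

(** * Groups with a simple virtual endomorphism of index p *)

Section SimpleToSplit.

Variables (p : nat) (gT : finGroupType) (G H : {group gT}).
Hypotheses (p_pr : prime p) (pG : p.-group G).
Hypotheses (nsHG : H <| G) (iHG : #|G : H| = p).

Lemma index_p_mul_cycle s : s \in G -> s \notin H -> H * <[s]> = G.
Proof.
move=> Gs nHs; apply: mulg_normal_maximal; rewrite ?cycle_subG //.
by apply: p_index_maximal; rewrite ?normal_sub ?iHG.
Qed.

Lemma complement_order_p s :
  s \in G -> s \notin H -> s ^+ p = 1 -> <[s]>%G \in [complements to H in G].
Proof.
move=> Gs nHs sp1; apply/complP; split; last exact: index_p_mul_cycle.
have os : #[s] = p.
  by apply: nt_prime_order => //; apply: contraNneq nHs => ->.
by rewrite setIC prime_TIg ?cycle_subG // -orderE os.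
Qed.

(** This element yields both halves of the structure theorem. The witness is
    found in the group [E] of elements of order dividing [p] in [H :&: 'Z(G)].
    Simplicity gives [h] in [H] with [phi h] outside [H]; as [H] is abelian,
    [phi @* E] centralises [phi h], and if it lay in [H] it would centralise [H]
    too, hence all of [G]. The nontrivial normal subgroup [E] would then be
    invariant. *)
Lemma simple_endo_central_escape (phi : {morphism H >-> gT}) :
    simple_endo G phi -> abelian H -> H :!=: 1 ->
  exists c, [/\ c \in H, c ^+ p = 1 & phi c \notin H].
Proof.
move=> [phiG simple_phi] cHH ntH.
have pZ : p.-group (H :&: 'Z(G)).
  by apply: pgroupS pG; rewrite subIset ?(normal_sub nsHG).
have cZ : abelian (H :&: 'Z(G)) by apply: abelianS cHH; rewrite subsetIl.
pose E := 'Ohm_1(H :&: 'Z(G))%G.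
have abE : p.-abelem E := Ohm1_abelem pZ cZ.
have [sEH sEZ] : E \subset H /\ E \subset 'Z(G).
  by apply/andP; rewrite -subsetI; apply: Ohm_sub.
have [phiEH | ] := boolP (phi @* E \subset H); last first.
  case/subsetPn=> _ /morphimP[c Hc Ec ->] nHc.
  by exists c; split=> //; case/(abelemP p_pr): abE => _ ->.
have ntE : E :!=: 1 by rewrite Ohm1_eq1 meet_center_nil ?(pgroup_nil pG).
have /subsetPn[_ /morphimP[h _ Hh ->] nHh] : ~~ (phi @* H \subset H).
  by apply: contra ntH => /(simple_phi H nsHG (subxx H)) ->.
have cphiE : phi @* E \subset 'C(G).
  have Gh : phi h \in G by rewrite (subsetP phiG) ?mem_morphim.
  rewrite -(index_p_mul_cycle Gh nHh).
  rewrite centM subsetI (subset_trans phiEH cHH) cent_cycle.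
  apply: subset_trans (morphimS phi sEH) _; rewrite sub_cent1.
  by rewrite (subsetP (morphim_abelian phi cHH)) ?mem_morphim.
case/eqP: ntE; apply: simple_phi => //; first exact: sub_center_normal.
rewrite -(Ohm1_id (morphim_abelem phi abE)) OhmS // subsetI phiEH subsetI cphiE.
by rewrite (subset_trans phiEH) ?normal_sub.
Qed.

(** With [c] as above, [phi c] generates a complement of [H]. Moreover every
    element of [H] can be corrected by a power of [c], without changing its
    [p]-th power, so that its image falls in [H]. Hence [phi] maps [p]-th powers
    in [H] to [p]-th powers in [H], and simplicity kills ['Mho^1(H)]. *)
Lemma simple_endo_split (phi : {morphism H >-> gT}) :
  simple_endo G phi -> abelian H -> split_elementary_abelian_by_Cp p G.
Proof.
move=> simple_phi cHH; have [phiG simpleK] := simple_phi.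
have pH : p.-group H := pgroupS (normal_sub nsHG) pG.
have oGH : #|G / H| = p by rewrite card_quotient ?normal_norm.
have cycGH : cyclic (G / H) by rewrite prime_cyclic ?oGH.
have [H1 | ntH] := eqVneq (H : {set gT}) 1.
  exists H; split; rewrite // H1 ?abelem1 //.
  by apply/splitsP; exists G; apply/complP; rewrite mul1g (setIidPl (sub1G G)).
have [c [Hc cp1 nHc]] := simple_endo_central_escape simple_phi cHH ntH.
have Gc : phi c \in G by rewrite (subsetP phiG) ?mem_morphim.
have Mho1 : 'Mho^1(H) = 1.
  apply: (simpleK 'Mho^1(H)%G); rewrite ?Mho_sub ?gFnormal_trans //=.
  rewrite (MhoEabelian 1 pH cHH) expn1.
  apply/subsetP=> _ /morphimP[_ _ /imsetP[h Hh ->] ->].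
  have: phi h \in H * <[phi c]>.
    by rewrite (index_p_mul_cycle Gc nHc) (subsetP phiG) ?mem_morphim.
  case/mulsgP=> a _ Ha /cycleP[i ->] def_h.
  have Hci : c ^+ i \in H by rewrite groupX.
  pose b := h * (c ^+ i)^-1.
  have Hb : b \in H by rewrite groupM ?groupV.
  have phib : phi b = a.
    by rewrite morphM ?groupV // morphV // def_h morphX // mulgK.
  have -> : h ^+ p = b ^+ p.
    rewrite expgMn; last by apply: (centsP cHH); rewrite ?groupV.
    by rewrite expgVn -expgM mulnC expgM cp1 expg1n invg1 mulg1.
  by rewrite morphX // phib; apply: imset_f.
exists H; split=> //; last first.
  apply/splitsP; exists <[phi c]>%G; apply: complement_order_p => //.
  by rewrite -morphX // cp1 morph1.
apply/(abelemP p_pr); split=> // h Hh; apply/set1gP; rewrite -Mho1.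
by rewrite (MhoEabelian 1 pH cHH) expn1; apply: imset_f.
Qed.

End SimpleToSplit.

(** * Simple virtual endomorphisms of split extensions *)

Section SplitToSimple.

Variables (p : nat) (gT : finGroupType).
Hypothesis p_pr : prime p.

(** In coordinates [f] is the shift [z_1 |-> t], [z_(i + 1) |-> z_i] for a basis
    [z_1, ..., z_d] of [Z]: iterating it on a nontrivial element eventually
    produces a nontrivial power of [t], so the element leaves [Z]. The induction
    removes [z = z_1] and lets it play the part of [t] for a complement [Y]. *)
Lemma truncated_shift (Z : {group gT}) t :
    p.-abelem Z -> t \in 'C(Z) -> t \notin Z -> t ^+ p = 1 ->
  exists2 f : {morphism Z >-> gT}, f @* Z \subset Z <*> <[t]>
    & forall K : {group gT}, K \subset Z -> f @* K \subset K -> K :=: 1.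
Proof.
have [n] := ubnP #|Z|; elim: n Z t => // n IHn Z t /ltnSE-leZn abZ cZt nZt tp1.
have [_ cZZ _] := and3P abZ.
have [Z1 | /trivgPn[z Zz ntz]] := eqVneq (Z : {set gT}) 1.
  exists (trivm Z) => [|K]; last by rewrite Z1 => /trivgP.
  by rewrite morphim_trivm sub1G.
have zp1 : z ^+ p = 1 by have [_ ->] := abelemP p_pr abZ.
have [Y defZ] : exists Y : {group gT}, Y \x <[z]> = Z.
  have [|Y] := abelem_split_dprod abZ (_ : <[z]> \subset Z).
    by rewrite cycle_subG.
  by rewrite dprodC; exists Y.
have [_ mulYZ cYz tiYz] := dprodP defZ.
have sYZ : Y \subset Z by rewrite -mulYZ mulG_subl.
have nYz : z \notin Y.
  by apply: contra ntz => Yz; apply/eqP/set1gP; rewrite -tiYz inE Yz cycle_id.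
have [||f fYZ simple_f] := IHn Y z _ (abelemS sYZ abZ) _ nYz zp1.
- apply: leq_trans leZn; apply: proper_card; rewrite properE sYZ.
  by apply/subsetPn; exists z.
- by rewrite -cycle_subG.
have {}fYZ : f @* Y \subset Z by rewrite -mulYZ -cent_joinEr.
have dv_t_z : #[t] %| #[z].
  by rewrite (nt_prime_order p_pr zp1 ntz) order_dvdn tp1.
have cft : eltm dv_t_z @* <[z]> \subset 'C(f @* Y).
  by rewrite im_eltm cycle_subG (subsetP (centS fYZ)).
exists (dprodm_morphism defZ cft) => [|K sKZ fKK].
  rewrite /= im_dprodm im_eltm cent_joinEr ?mulSg //.
  by rewrite cycle_subG.
(* The t-component of the image of an element is its z-component. *)
have sKY : K \subset Y.
  apply/subsetP=> k Kk; have Zk := subsetP sKZ k Kk.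
  have: dprodm defZ cft k \in Z.
    by rewrite (subsetP sKZ) // (subsetP fKK) //; apply: mem_morphim.
  move: Zk Kk; rewrite -{1}mulYZ => /mulsgP[y _ Yy /cycleP[i ->] ->] _.
  rewrite dprodmE ?mem_cycle // morphX ?cycle_id //= eltm_id.
  rewrite groupMl => [Zti|]; last by rewrite (subsetP fYZ) ?mem_morphim.
  have: <[t]> :&: Z = 1.
    rewrite prime_TIg ?cycle_subG // -orderE.
    rewrite (nt_prime_order p_pr tp1) //.
    by apply: contraNneq nZt => ->.
  move/setP/(_ (t ^+ i)); rewrite !inE mem_cycle Zti => /esym.
  rewrite -order_dvdn (nt_prime_order p_pr tp1); last first.
    by apply: contraNneq nZt => ->.
  by case/dvdnP=> j ->; rewrite mulnC expgM zp1 expg1n mulg1.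
by apply: simple_f => //; apply: subset_trans fKK; rewrite /= morphim_dprodml.
Qed.

(** It is enough to control [phi] on [Z = H :&: 'Z(G)], because every nontrivial
    normal subgroup of the [p]-group [G] meets the centre. So [phi] is the
    truncated shift on [Z], with [t] a generator of a complement of [H], and is
    trivial on a complement of [Z] in [H]. *)
Lemma split_simple_endo (G H : {group gT}) :
    p.-group G -> H <| G -> p.-abelem H -> #|G / H| = p -> [splits G, over H] ->
  exists phi : {morphism H >-> gT}, simple_endo G phi.
Proof.
move=> pG nsHG abH oGH /splitsP[T /complP[tiHT mulHT]].
have oT : #|T| = p.
  rewrite -oGH -mulHT quotientMidl -(card_isog (quotient_isog _ _)) //.
  by apply: subset_trans (normal_norm nsHG); rewrite -mulHT mulG_subr.
have [t defT] : exists t, T :=: <[t]> by apply/cyclicP/prime_cyclic; rewrite oT.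
have sTG : T \subset G by rewrite -mulHT mulG_subr.
have Gt : t \in G by rewrite -cycle_subG -defT.
have ot : #[t] = p by rewrite orderE -defT.
pose Z := (H :&: 'Z(G))%G.
have sZH : Z \subset H := subsetIl _ _.
have sZG : Z \subset G := subset_trans sZH (normal_sub nsHG).
have cZG : G \subset 'C(Z) by rewrite centsC !subIset ?subxx ?orbT.
have cZt : t \in 'C(Z) by apply: subsetP Gt.
have nHt : t \notin H.
  apply: contraL (prime_gt1 p_pr) => Ht.
  have t1 : t = 1 by apply/set1gP; rewrite -tiHT inE Ht defT cycle_id.
  by rewrite -ot t1 order1.
have [||f fZ simple_f] := truncated_shift (abelemS sZH abH) cZt.
- by apply: contra nHt; apply: subsetP.
- by rewrite -ot expg_order.
have [W defH] := abelem_split_dprod abH sZH.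
have cfW : trivm W @* W \subset 'C(f @* Z) by rewrite morphim_trivm sub1G.
have fHZ: dprodm defH cfW @* H \subset Z <*> <[t]>.
  by rewrite im_dprodm morphim_trivm mulg1.
exists (dprodm_morphism defH cfW); split=> [|K nsKG sKH fKK] /=.
  by apply: subset_trans fHZ _; rewrite join_subG sZG cycle_subG.
apply: contraTeq isT => ntK.
have /negP[] := meet_center_nil (pgroup_nil pG) nsKG ntK.
apply/eqP; apply: (simple_f (K :&: 'Z(G))%G) => /=; first exact: setSI.
have sKZ : K :&: 'Z(G) \subset Z by apply: setSI.
rewrite -(morphim_dprodml defH cfW) // subsetI.
have fK : dprodm defH cfW @* (K :&: 'Z(G)) \subset K.
  by apply: subset_trans fKK; rewrite /= morphimS ?subsetIl.
rewrite fK /=.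
(* As H meets <[t]> trivially, an image under phi that is in H is even in Z. *)
have ZtH : (Z <*> <[t]>) :&: H = Z.
  rewrite cent_joinEr ?cycle_subG // -group_modl //= -defT.
  by rewrite [_ :&: H]setIC tiHT mulg1.
apply: subset_trans (subsetIr H 'Z(G)); rewrite -[H :&: _]ZtH subsetI.
rewrite (subset_trans fK sKH) andbT.
by apply: subset_trans fHZ; rewrite /= morphimS // (subset_trans sKZ).
Qed.

End SplitToSimple.

(** * Tree actions defined by automata *)

(** Elementary rules for partial actions on a type that need not be finite, such
    as the set of words. *)
Section ActionOnType.

Variables (gT : finGroupType) (G : {group gT}) (T : Type) (to : action G T).

Lemma act_mul : {in G &, forall g h x, to x (g * h) = to (to x g) h}.
Proof. by case: (to) => f [? fM] g h Gg Gh x; apply: fM. Qed.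

Lemma act_one x : to x 1 = x.
Proof.
have inj_to : left_injective to by case: (to) => f [].
by apply: (inj_to 1); rewrite -act_mul ?mulg1.
Qed.

Lemma act_invK g x : g \in G -> to (to x g^-1) g = x.
Proof. by move=> Gg; rewrite -act_mul ?groupV // mulVg act_one. Qed.

Lemma act_Kinv g x : g \in G -> to (to x g) g^-1 = x.
Proof. by move=> Gg; rewrite -act_mul ?groupV // mulgV act_one. Qed.

End ActionOnType.

(** The elements of [G] are the states of a letter-to-letter transducer. The
    hypotheses on [out] and [next] are the composition rules of root
    permutations and of sections, for right actions. *)
Section Automaton.

Variables (k : nat) (gT : finGroupType) (G : {group gT}).
Variables (out : gT -> 'I_k -> 'I_k) (next : gT -> 'I_k -> gT).

Fixpoint run (w : word k) (g : gT) : word k :=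
  if w is x :: w' then out g x :: run w' (next g x) else [::].

Hypothesis next_in : {in G, forall g x, next g x \in G}.
Hypothesis out1 : forall x, out 1 x = x.
Hypothesis next1 : forall x, next 1 x = 1.
Hypothesis outM : {in G &, forall g h x, out (g * h) x = out h (out g x)}.
Hypothesis nextM :
  {in G &, forall g h x, next (g * h) x = next g x * next h (out g x)}.

(** An action on words must be injective also for elements outside [G], where
    [run] may fail to be. *)
Definition tree_run (w : word k) (g : gT) := if g \in G then run w g else w.

Lemma run1 w : run w 1 = w.
Proof. by elim: w => //= x w IHw; rewrite out1 next1 IHw. Qed.

Lemma runM w : {in G &, forall g h, run w (g * h) = run (run w g) h}.
Proof.
elim: w => //= x w IHw g h Gg Gh.
by rewrite outM // nextM // IHw ?next_in.
Qed.

Lemma run_can g w : g \in G -> run (run w g) g^-1 = w.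
Proof. by move=> Gg; rewrite -runM ?groupV // mulgV run1. Qed.

Lemma tree_run_is_action : is_action G tree_run.
Proof.
split=> [g u v | w g h Gg Gh]; rewrite /tree_run; last first.
  by rewrite groupM // Gg Gh runM.
by case: ifP => // Gg /(congr1 (run^~ g^-1)); rewrite /= !run_can.
Qed.

Definition tree_action := Action tree_run_is_action.

Lemma tree_actionE g w : g \in G -> tree_action w g = run w g.
Proof. by rewrite /= /tree_run => ->. Qed.

Lemma tree_action_cons :
  {in G, forall g x w,
     tree_action (x :: w) g = out g x :: tree_action w (next g x)}.
Proof. by move=> g Gg x w; rewrite !tree_actionE ?next_in. Qed.

Lemma out_inj g : g \in G -> injective (out g).
Proof.
move=> Gg x y Exy; rewrite -(out1 x) -(out1 y) -(mulgV g).
by rewrite !outM ?groupV // Exy.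
Qed.

Lemma size_run w g : size (run w g) = size w.
Proof. by elim: w g => //= x w IHw g; rewrite IHw. Qed.

Lemma child_run g u v : g \in G -> child (run u g) (run v g) = child u v.
Proof.
have nil_child (w : word k) : child [::] w = (size w == 1%N).
  apply/childP/eqP=> [[x ->] // | ].
  by case: w => [|x []] // _; exists x.
elim: u v g => [|x u IHu] [|y v] g Gg; rewrite /= ?nil_child /= ?size_run //.
have [-> | neq_xy] := eqVneq x y.
  by rewrite /= !child_cons IHu ?next_in.
have child_head (a b : 'I_k) (s t : word k) :
  a != b -> child (a :: s) (b :: t) = false.
  by move=> neq_ab; apply/childP=> -[z [Eba _]]; rewrite Eba eqxx in neq_ab.
by rewrite /= !child_head // (inj_eq (out_inj Gg)).
Qed.

Lemma tree_action_aut : acts_by_tree_aut tree_action.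
Proof.
move=> g Gg; split=> [||u v].
- exists (fun w => run w g^-1) => w; rewrite tree_actionE ?run_can //.
  by rewrite -{2}(invgK g) run_can ?groupV.
- by rewrite tree_actionE.
by rewrite /tree_adj /= /tree_run Gg !child_run.
Qed.

Lemma tree_action_self_similar : self_similar tree_action.
Proof.
move=> g Gg x; exists (next g x) => [|w]; first exact: next_in.
exact: (congr1 behead (tree_action_cons Gg x w)).
Qed.

End Automaton.

(** The set of words is infinite, so the kernel of an action on it is not given
    as a finite set. The elements reachable from one element of the kernel by
    conjugation and by taking sections form a finite substitute. *)
Section AutomatonOrbit.

Variables (k : nat) (gT : finGroupType) (G : {group gT}).
Variables (out : gT -> 'I_k -> 'I_k) (next : gT -> 'I_k -> gT).
Variable to : action G (word k).
Hypothesis next_in : {in G, forall g x, next g x \in G}.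
Hypothesis to_cons :
  {in G, forall g x w, to (x :: w) g = out g x :: to w (next g x)}.

Definition automaton_step (a b : gT) :=
  (b \in a ^: G) || [exists x, b == next a x].

Lemma orbit_trivial g h :
    g \in G -> (forall w, to w g = w) -> connect automaton_step g h ->
  h \in G /\ forall w, to w h = w.
Proof.
move=> Gg fix_g /connectP[s + ->].
elim: s g Gg fix_g => //= a s IHs g Gg fix_g /andP[g_a]; apply: IHs.
  case/orP: g_a => [/imsetP[y Gy ->] | /existsP[x /eqP->]].
    by rewrite groupJ.
  exact: next_in.
case/orP: g_a => [/imsetP[y Gy ->] | /existsP[x /eqP->]] w.
  by rewrite conjgE !act_mul ?groupM ?groupV // fix_g act_invK.
by have := fix_g (x :: w); rewrite to_cons // => -[].
Qed.

End AutomatonOrbit.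

(** * The tree action of a virtual endomorphism *)

(** Letters number the right cosets of [H], on which [G] acts by translation. If
    [g] maps the coset of [r_x] to that of [r_y], then [r_x * g * r_y^-1] is in
    [H], and its image under [phi] is the section of [g] at [x]. *)
Section CosetTree.

Variables (gT : finGroupType) (G H : {group gT}) (phi : {morphism H >-> gT}).
Hypotheses (sHG : H \subset G) (phiG : phi @* H \subset G).

Let k := #|G : H|.

Lemma coset_base : (H : {set gT}) \in rcosets H G.
Proof. by apply/rcosetsP; exists 1; rewrite ?mulg1. Qed.

Definition coset_rep (x : 'I_k) : gT := repr (enum_val x).
Definition coset_index (g : gT) : 'I_k := enum_rank_in coset_base (H :* g).

Lemma mem_coset_rep x : coset_rep x \in G.
Proof.
rewrite /coset_rep; have /rcosetsP[g Gg ->] := enum_valP x.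
have /rcosetP[h Hh ->] := mem_repr_rcoset H g.
by rewrite groupM // (subsetP sHG).
Qed.

Lemma coset_repK x : coset_index (coset_rep x) = x.
Proof.
rewrite /coset_index /coset_rep; have /rcosetsP[g Gg def_x] := enum_valP x.
by rewrite def_x rcoset_repr -def_x enum_valK_in.
Qed.

Lemma coset_indexE g : g \in G -> H :* coset_rep (coset_index g) = H :* g.
Proof.
move=> Gg; rewrite /coset_rep /coset_index enum_rankK_in ?rcoset_repr //.
by apply/rcosetsP; exists g.
Qed.

Lemma coset_index_eq g h : H :* g = H :* h -> coset_index g = coset_index h.
Proof. by rewrite /coset_index => ->. Qed.

Definition coset_out g x := coset_index (coset_rep x * g).
Definition coset_next g x :=
  phi (coset_rep x * g * (coset_rep (coset_out g x))^-1).

Lemma coset_step g x :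
  g \in G -> coset_rep x * g * (coset_rep (coset_out g x))^-1 \in H.
Proof.
move=> Gg; rewrite -mem_rcoset coset_indexE ?groupM ?mem_coset_rep //.
exact: rcoset_refl.
Qed.

Lemma coset_next_in : {in G, forall g x, coset_next g x \in G}.
Proof. by move=> g Gg x; rewrite (subsetP phiG) ?mem_morphim ?coset_step. Qed.

Lemma coset_out1 x : coset_out 1 x = x.
Proof. by rewrite /coset_out mulg1 coset_repK. Qed.

Lemma coset_next1 x : coset_next 1 x = 1.
Proof. by rewrite /coset_next coset_out1 mulg1 mulgV morph1. Qed.

Lemma coset_outM :
  {in G &, forall g h x, coset_out (g * h) x = coset_out h (coset_out g x)}.
Proof.
move=> g h Gg Gh x; apply: coset_index_eq.
by rewrite mulgA rcosetM -(coset_indexE (groupM (mem_coset_rep x) Gg)) -rcosetM.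
Qed.

Lemma coset_nextM :
  {in G &, forall g h x,
     coset_next (g * h) x = coset_next g x * coset_next h (coset_out g x)}.
Proof.
move=> g h Gg Gh x; rewrite /coset_next coset_outM // -morphM ?coset_step //.
by rewrite !mulgA mulgKV.
Qed.

Definition coset_tree_action : action G (word k) :=
  tree_action coset_next_in coset_out1 coset_next1 coset_outM coset_nextM.

Lemma coset_tree_action_cons :
  {in G, forall g x w,
     coset_tree_action (x :: w) g
       = coset_out g x :: coset_tree_action w (coset_next g x)}.
Proof. exact: tree_action_cons. Qed.

(** An element that fixes the coset [H] itself is in [H]. *)
Lemma level1_stab_coset : level1_stab coset_tree_action \subset H.
Proof.
apply/subsetP=> g; rewrite inE => /andP[Gg /forallP/(_ (coset_index 1))/eqP].
rewrite coset_tree_action_cons // => -[out_g].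
have := coset_indexE (groupM (mem_coset_rep (coset_index 1)) Gg).
rewrite -/(coset_out g (coset_index 1)) out_g rcosetM coset_indexE ?group1 //.
rewrite !mulg1 => -> _.
exact: rcoset_refl.
Qed.

(** Any [g] acting trivially lies in the subgroup generated by the elements
    reachable from [g]. These act trivially, hence lie in [H], and they are
    permuted by conjugation. They are also preserved by [phi]: for any letter
    [x], [phi a] is the section at [x] of the conjugate [a ^ r_x]. *)
Lemma coset_tree_action_faithful :
    (forall K : {group gT}, K <| G -> K \subset H -> phi @* K \subset K ->
       K :=: 1) ->
  faithful_on_tree coset_tree_action.
Proof.
move=> simple_phi g Gg fix_g.
pose S := [set h | connect (automaton_step G coset_next) g h].
have fixS h : h \in S -> h \in G /\ forall w, coset_tree_action w h = w.
  rewrite inE.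
  exact: (orbit_trivial coset_next_in coset_tree_action_cons Gg fix_g).
have sSH : S \subset H.
  apply/subsetP=> h /fixS[Gh fix_h]; apply: (subsetP level1_stab_coset).
  by rewrite inE Gh; apply/forallP=> x; rewrite fix_h.
have stepS a b : a \in S -> automaton_step G coset_next a b -> b \in S.
  by rewrite !inE => ga ab; apply: connect_trans ga (connect1 ab).
have SJ a y : a \in S -> y \in G -> a ^ y \in S.
  by move=> Sa Gy; apply: stepS Sa _; rewrite /automaton_step memJ_class.
suffices S1 : <<S>> = 1.
  by apply/set1gP; rewrite -S1 mem_gen // inE connect0.
apply: (simple_phi <<S>>%G) => /=; last 1 first.
- rewrite morphim_gen // genS //; apply/subsetP=> _ /morphimP[a Ha Sa ->].
  have [Ga _] := fixS a Sa.
  pose x := coset_index 1; have Gx := mem_coset_rep x.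
  have Sax := SJ a _ Sa Gx; have [Gax fix_ax] := fixS _ Sax.
  apply: stepS Sax _; apply/orP; right; apply/existsP; exists x; apply/eqP.
  have := fix_ax [:: x]; rewrite coset_tree_action_cons // => -[out_ax].
  by rewrite /coset_next out_ax -conjgC mulgK.
- rewrite /normal gen_subG (subset_trans sSH sHG) norms_gen //.
  apply/subsetP=> y Gy; rewrite inE; apply/subsetP=> _ /imsetP[a Sa ->].
  exact: SJ.
- by rewrite gen_subG.
Qed.

End CosetTree.

(** * The virtual endomorphism of a tree action *)

(** The square of [p] does not divide the factorial of [p], by Wilson's
    theorem. *)
Lemma p_subgroup_Sp_card p (P : {group {perm 'I_p}}) :
  prime p -> p.-group P -> #|P| %| p.
Proof.
move=> p_pr pP; have [n oP] := p_natP pP.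
have: #|P| %| p`! by rewrite -card_Sn -cardsT cardSg ?subsetT.
rewrite oP; case: n {oP} => [|[|n]] // dvP.
have p_gt0 := prime_gt0 p_pr.
have: p %| (p.-1)`!.
  rewrite -(dvdn_pmul2l p_gt0) -{3}(prednK p_gt0) -factS prednK //.
  by apply: dvdn_trans dvP; rewrite !expnS mulnA dvdn_mulr.
move=> dv_fact; have := Wilson (prime_gt1 p_pr).
rewrite p_pr -addn1 dvdn_addr // => /esym; rewrite dvdn1 => /eqP p1.
by rewrite p1 in p_pr.
Qed.

Section TreeToEndo.

Variables (k : nat) (gT : finGroupType) (G : {group gT}).
Variable to : action G (word k).
Hypotheses (aut_to : acts_by_tree_aut to) (faith_to : faithful_on_tree to).

Lemma act_nil g : g \in G -> to [::] g = [::].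
Proof. by case/aut_to. Qed.

Lemma faithful_eq : {in G &, forall g h, (forall w, to w g = to w h) -> g = h}.
Proof.
move=> g h Gg Gh eq_gh; apply: (mulIg h^-1); rewrite mulgV.
apply: faith_to => [|w]; first by rewrite groupM ?groupV.
by rewrite act_mul ?groupV // eq_gh act_Kinv.
Qed.

(** Faithfulness, through [faithful_eq], makes sections unique as elements of
    [G]; this is what turns [next] into a cocycle in [next_mul]. *)
Lemma wreath_decomposition : self_similar to ->
  exists (s : {morphism G >-> {perm 'I_k}}) (next : gT -> 'I_k -> gT),
    {in G, forall g x, next g x \in G} /\
    {in G, forall g x w, to (x :: w) g = s g x :: to w (next g x)}.
Proof.
move=> sim_to.
have /fin_all_exists[s toE] (g : gT) : exists s : {perm 'I_k}, g \in G ->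
    forall x w, to (x :: w) g = s x :: Defs.section (fun w => to w g) x w.
  have [Gg | _] := boolP (g \in G); last by exists 1.
  by have [s gE] := tree_autE (aut_to Gg); exists s.
have /fin_all_exists[f fE] (gx : gT * 'I_k) : exists h : gT, gx.1 \in G ->
    h \in G /\ Defs.section (fun w => to w gx.1) gx.2 =1 (fun w => to w h).
  have [Gg | _] := boolP (gx.1 \in G); last by exists 1.
  by have [h Gh hE] := sim_to _ Gg gx.2; exists h.
have sM : {in G &, {morph s : g h / g * h}}.
  move=> g h Gg Gh; apply/permP=> x; rewrite permM.
  have := act_mul to Gg Gh [:: x].
  by rewrite (toE _ (groupM Gg Gh)) (toE _ Gg) (toE _ Gh) => -[].
exists (Morphism sM), (fun g x => f (g, x)); split=> g Gg x.
  by have [] := fE (g, x) Gg.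
by move=> w /=; rewrite (toE _ Gg); have [_ /= ->] := fE (g, x) Gg.
Qed.

Variables (s : {morphism G >-> {perm 'I_k}}) (next : gT -> 'I_k -> gT).
Hypothesis next_in : {in G, forall g x, next g x \in G}.
Hypothesis to_cons :
  {in G, forall g x w, to (x :: w) g = s g x :: to w (next g x)}.

Lemma next_mul :
  {in G &, forall g h x, next (g * h) x = next g x * next h (s g x)}.
Proof.
move=> g h Gg Gh x; apply: faithful_eq => [||w].
- by rewrite next_in ?groupM.
- by rewrite groupM ?next_in.
have := act_mul to Gg Gh (x :: w).
by rewrite !to_cons ?groupM // act_mul ?next_in // => -[].
Qed.

Lemma level1_fix h x : h \in 'ker s -> s h x = x.
Proof. by move=> Kh; rewrite (mker Kh) perm1. Qed.

Lemma ker_level1_stab : 'ker s \subset level1_stab to.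
Proof.
apply/subsetP=> h Kh; have Gh := dom_ker Kh.
rewrite inE Gh; apply/forallP=> x.
by rewrite to_cons // level1_fix // act_nil ?next_in.
Qed.

(** Read off from [h * g = g * h ^ g]. For a normal subgroup, it carries
    information on sections at one letter to all letters of its orbit. *)
Lemma next_conj h g x : h \in 'ker s -> g \in G ->
  next (h ^ g) (s g x) = next h x ^ next g x.
Proof.
move=> Kh Gg; have Gh := dom_ker Kh.
apply: (mulgI (next g x)); rewrite -next_mul ?groupJ // -!conjgC.
by rewrite next_mul // level1_fix.
Qed.

(** Elements of such a [K] fix the first letter of a word and act on its tail by
    an element of [K], hence fix all words. *)
Lemma invariant_trivial (K : {group gT}) :
    K \subset 'ker s -> {in K, forall h x, next h x \in K} -> K :=: 1.
Proof.
move=> sKker nextK; apply/trivgP/subsetP=> h Kh; apply/set1gP.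
have sKG : K \subset G := subset_trans sKker (normal_sub (ker_normal s)).
apply: faith_to => [|w]; first exact: subsetP Kh.
elim: w h Kh => [|x w IHw] h Kh; first by rewrite act_nil ?(subsetP sKG).
by rewrite to_cons ?(subsetP sKG) // level1_fix ?(subsetP sKker) // IHw ?nextK.
Qed.

Lemma next_ker_morph x : {in 'ker s &, {morph next^~ x : g h / g * h}}.
Proof.
move=> g h Kg Kh /=; rewrite (next_mul (dom_ker Kg) (dom_ker Kh)).
by rewrite (level1_fix _ Kg).
Qed.

Definition endo_at x : {morphism 'ker s >-> gT} := Morphism (next_ker_morph x).

(** By transitivity a normal subgroup that is stable under sections at the one
    letter [x] is stable under sections at all letters. *)
Lemma endo_at_simple x :
  (forall y, exists2 g, g \in G & s g x = y) -> simple_endo G (endo_at x).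
Proof.
move=> trans_s; split=> [|K nsKG sKker fKK].
  apply/subsetP=> _ /morphimP[h _ Kh ->].
  exact: next_in (dom_ker Kh) x.
apply: invariant_trivial => // h Kh y; have [g Gg <-] := trans_s y.
have [sKG nKG] := andP nsKG.
have Khg : h ^ g^-1 \in K by rewrite memJ_norm // groupV (subsetP nKG).
rewrite -[h](conjgKV g) next_conj ?(subsetP sKker) //.
rewrite memJ_norm ?(subsetP nKG) ?next_in //.
apply: (subsetP fKK); apply: (mem_morphim (endo_at x)) => //.
exact: subsetP Khg.
Qed.

(** If the root permutations were all trivial, [G] would be its own first level
    stabilizer and would act trivially. *)
Lemma root_image_card : prime k -> k.-group G -> G :!=: 1 -> #|s @* G| = k.
Proof.
move=> k_pr kG ntG; have := p_subgroup_Sp_card k_pr (morphim_pgroup s kG).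
case/(primeP k_pr).2/pred2P => // /eqP; rewrite -trivg_card1 => sG1.
case/eqP: ntG; have sGker : G \subset 'ker s.
  by rewrite ker_trivg_morphim subxx; apply/trivgP/eqP.
by apply: invariant_trivial => // g Gg x; apply: next_in.
Qed.

Lemma root_transitive : prime k -> k.-group G -> G :!=: 1 ->
  exists x, forall y, exists2 g, g \in G & s g x = y.
Proof.
move=> k_pr kG ntG; have oP := root_image_card k_pr kG ntG.
have /trivgPn[_ /morphimP[g Gg _ ->] nt_sg] : s @* G != 1.
  by rewrite trivg_card1 oP neq_ltn prime_gt1 ?orbT.
have /existsP[x sgx] : [exists x, s g x != x].
  apply: contraNT nt_sg => /existsPn fix_g; apply/eqP/permP=> x.
  by rewrite perm1; apply/eqP; have := fix_g x; rewrite negbK.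
exists x => y.
have := dvdn_orbit 'P (s @* G) x; rewrite oP.
case/(primeP k_pr).2/pred2P=> [/card_orbit1 fix_x | orb_x].
  case/eqP: sgx; apply/set1P; rewrite -fix_x.
  by apply/orbitP; exists (s g); rewrite ?mem_morphim.
have: y \in orbit 'P (s @* G) x.
  have /eqP-> // : orbit 'P (s @* G) x == setT.
  by rewrite eqEcard subsetT cardsT card_ord orb_x leqnn.
by case/orbitP=> _ /morphimP[h Gh _ ->] <-; exists h.
Qed.

End TreeToEndo.

Theorem theorem1 (p : nat) (gT : finGroupType) (G : {group gT}) :
  prime p -> p.-group G -> G :!=: 1 ->
  (exists to : action G (word p),
     [/\ acts_by_tree_aut to, faithful_on_tree to, self_similar to
       & abelian (level1_stab to)])
  <-> split_elementary_abelian_by_Cp p G.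
Proof.
move=> p_pr pG ntG; split=> [[to [aut_to faith_to sim_to cKK]] | ].
  have [s [next [next_in to_cons]]] := wreath_decomposition aut_to sim_to.
  have [x trans_s] :=
    root_transitive aut_to faith_to next_in to_cons p_pr pG ntG.
  have simple_phi := endo_at_simple aut_to faith_to next_in to_cons trans_s.
  apply: (simple_endo_split p_pr pG (ker_normal s) _ simple_phi).
    rewrite -{1}(setIid G) -card_morphim.
    exact: (root_image_card aut_to faith_to next_in to_cons).
  exact: abelianS (ker_level1_stab aut_to next_in to_cons) cKK.
case=> H [nsHG abH _ oGH splitG].
have [phi [phiG simple_phi]] := split_simple_endo p_pr pG nsHG abH oGH splitG.
rewrite card_quotient ?normal_norm // in oGH; rewrite -oGH.
exists (coset_tree_action (normal_sub nsHG) phiG); split.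
- exact: tree_action_aut.
- exact: coset_tree_action_faithful.
- exact: tree_action_self_similar.
- exact: abelianS (level1_stab_coset _ _) (abelem_abelian abH).
Qed.
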